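(* Let $m\ge 1$ and let $n_1,\dots,n_m\ge 1$ be integers. Let $S(P_{n_1}\square\cdots\square P_{n_m})$ be the shortest path graph of the grid graph $P_{n_1}\square\cdots\square P_{n_m}$ with respect to the vertices $(0,\dots,0)$ and $(n_1,\dots,n_m)$. Then $S(P_{n_1}\square\cdots\square P_{n_m})$ is isomorphic to an induced subgraph of the integer lattice graph $\mathbb{Z}^M$, where $M=\sum_{i=2}^{m}(i-1)n_i$.
   Context: For a graph $G$ with distinct vertices $a,b$, a shortest $a,b$-path is a path between $a$ and $b$ of length $d_G(a,b)$. The shortest path graph $S(G,a,b)$ is the graph whose vertices are the shortest $a,b$-paths in $G$, two of them being adjacent if and only if the corresponding paths differ in exactly one vertex. $P_n$ denotes the path of length $n$ (with $n+1$ vertices $0,1,\dots,n$). The grid graph $P_{n_1}\square\cdots\square P_{n_m}$ (Cartesian product of paths) has vertex set $\{(x_1,\dots,x_m): x_i\in\mathbb{Z},\ 0\le x_i\le n_i\}$, two vertices being adjacent if and only if they differ by exactly $1$ in one coordinate and agree in all others. The integer lattice graph $\mathbb{Z}^M$ has vertex set $\mathbb{Z}^M$, with two vertices adjacent if and only if they differ by exactly $1$ in one coordinate and agree in all others. *)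

(* Defs.v *)
From HB Require Import structures.
From mathcomp Require Import all_boot all_order all_algebra.

Set Implicit Arguments.
Unset Strict Implicit.
Unset Printing Implicit Defensive.

Import Order.TTheory GRing.Theory Num.Theory.

Record sgraph (T : Type) := SGraph {
  adj :> rel T;
  adj_sym : symmetric adj;
  adj_irr : irreflexive adj
}.

Definition isomorphic (T U : Type) (G : sgraph T) (H : sgraph U) : Prop :=
  exists f : T -> U, bijective f /\ forall x y, H (f x) (f y) = G x y.

Section Induced.
Variables (T : Type) (G : sgraph T) (W : pred T).

Definition induced_adj : rel {x : T | W x} := fun x y => G (sval x) (sval y).

Fact induced_sym : symmetric induced_adj.
Proof. by move=> x y; apply: adj_sym. Qed.

Fact induced_irr : irreflexive induced_adj.
Proof. by move=> x; apply: adj_irr. Qed.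

Definition induced_subgraph : sgraph {x : T | W x} :=
  SGraph induced_sym induced_irr.

End Induced.

Section ShortestPaths.
Variables (T : finType) (G : sgraph T) (a b : T).

(* The path with vertex sequence a :: p; its length is size p. *)
Definition is_path (p : seq T) : bool :=
  [&& path G a p, last a p == b & uniq (a :: p)].

(* A path has fewer than #|T| edges; the value is #|T| when a and b are not
   connected. *)
Definition dist : nat :=
  find (fun k => [exists p : k.-tuple T, is_path p]) (iota 0 #|T|).

Definition shortest_path : finType := {p : dist.-tuple T | is_path p}.

(* The common first vertex a is not stored. A vertex at position k of a shortest
   path is at distance k from a, so counting differing positions is the same as
   comparing vertex sets. *)
Definition sp_adj : rel shortest_path := fun p q =>
  #|[set k : 'I_dist | tnth (val p) k != tnth (val q) k]| == 1.

Fact sp_sym : symmetric sp_adj.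
Proof.
by move=> p q; rewrite /sp_adj; under eq_finset => k do rewrite eq_sym.
Qed.

Fact sp_irr : irreflexive sp_adj.
Proof.
by move=> p; rewrite /sp_adj eq_card0 // => k; rewrite inE eqxx.
Qed.

Definition shortest_path_graph : sgraph shortest_path := SGraph sp_sym sp_irr.

End ShortestPaths.

Section UnitStep.
Local Open Scope ring_scope.
Variable I : finType.

Definition unit_step (x y : I -> int) : bool :=
  [exists i, (`|x i - y i| == 1) && [forall j, (j != i) ==> (x j == y j)]].

Lemma unit_step_sym : symmetric unit_step.
Proof.
move=> x y; apply: eq_existsb => i; rewrite distrC; congr (_ && _).
by apply: eq_forallb => j; rewrite [x j == _]eq_sym.
Qed.

Lemma unit_step_irr : irreflexive unit_step.
Proof.
by move=> x; apply/negbTE/negP => /existsP[i]; rewrite subrr normr0.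
Qed.

End UnitStep.

Section Lattice.
Variable M : nat.

Definition lattice_adj : rel {ffun 'I_M -> int} := fun x y => unit_step x y.

Fact lattice_sym : symmetric lattice_adj.
Proof. by move=> x y; apply: unit_step_sym. Qed.

Fact lattice_irr : irreflexive lattice_adj.
Proof. by move=> x; apply: unit_step_irr. Qed.

Definition lattice_graph : sgraph {ffun 'I_M -> int} :=
  SGraph lattice_sym lattice_irr.

End Lattice.

Section Grid.
Variables (m : nat) (n : 'I_m -> nat).

(* The side lengths n_1, ..., n_m are n 0, ..., n (m - 1). *)
Definition grid : finType := {dffun forall i : 'I_m, 'I_(n i).+1}.

Definition grid_adj : rel grid := fun x y =>
  unit_step (fun i => Posz (x i)) (fun i => Posz (y i)).

Fact grid_sym : symmetric grid_adj.
Proof. by move=> x y; apply: unit_step_sym. Qed.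

Fact grid_irr : irreflexive grid_adj.
Proof. by move=> x; apply: unit_step_irr. Qed.

Definition grid_graph : sgraph grid := SGraph grid_sym grid_irr.

Definition grid_origin : grid := finfun (fun i : 'I_m => @ord0 (n i)).

Definition grid_corner : grid := finfun (fun i : 'I_m => @ord_max (n i)).

End Grid.

(* Main.v *)
(* Recording the direction of each step turns a shortest path into a word in
   which the letter i occurs n_i times, and two paths differ in exactly one
   vertex iff their words differ by exchanging two distinct adjacent letters.
   Send a word to the numbers of letters j preceding the k-th occurrence of i,
   for all j < i and all k: there are M of them, they record the relative order
   of any two occurrences of distinct letters and so determine the word, and an
   exchange of adjacent letters changes one of them by 1. Conversely, if only
   one of them changes, by 1, then the order of a single pair of occurrences is
   reversed, and such a pair must be adjacent in both words. *)

Require Import Defs.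
From HB Require Import structures.
From mathcomp Require Import all_boot all_order all_algebra.
From mathcomp Require Import zify.

Set Implicit Arguments.
Unset Strict Implicit.
Unset Printing Implicit Defensive.

(** * Words, their prefixes, and exchanges of adjacent letters *)

Inductive swap : seq nat -> seq nat -> Prop :=
| swap_head a b s : a != b -> swap [:: a, b & s] [:: b, a & s]
| swap_cons x s s' : swap s s' -> swap (x :: s) (x :: s').

Lemma swap_sym s s' : swap s s' -> swap s' s.
Proof.
by elim=> [a b r ab | x r r' _]; [apply: swap_head; rewrite eq_sym | apply: swap_cons].
Qed.

Lemma perm_eq_swap_head (T : eqType) (a b : T) s s' :
  perm_eq [:: a, b & s] [:: b, a & s'] = perm_eq s s'.
Proof. by rewrite (permPl (permEl (perm_catCA [:: a] [:: b] s))) !perm_cons. Qed.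

Lemma perm_take_inj (T : eqType) (s s' : seq T) :
  size s = size s' -> (forall t, perm_eq (take t s) (take t s')) -> s = s'.
Proof.
elim: s s' => [|x s IHs] [|y s'] //= [eq_sz] eq_take.
have := eq_take 1; rewrite /= !take0 => /perm_mem/(_ x).
rewrite !inE eqxx => /esym/eqP xy; congr (_ :: _) => //.
by apply: IHs => // t; have := eq_take t.+1; rewrite /= xy perm_cons.
Qed.

(* For the words of two paths, the vertices reached after t steps agree iff the
   prefixes of length t are permutations of each other. *)
Definition one_take_differs (s s' : seq nat) : Prop :=
  exists2 t, ~~ perm_eq (take t s) (take t s') &
    forall u, u != t -> perm_eq (take u s) (take u s').

(** From right to left, an exchange disturbs only the prefix ending between the two letters.
    Conversely, after the common beginning is stripped the first letters differ, so the exceptional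
    prefix has length 1; agreement at length 2 forces the exchange, and agreement at all greater
    lengths makes the tails equal. *)
Lemma swapP s s' : size s = size s' -> one_take_differs s s' <-> swap s s'.
Proof.
move=> eq_sz; split; last first.
  elim=> [a b r ab | x r r' _ [t ne_t eq_t]].
    exists 1 => [|[|[|u]] //= _]; rewrite /= ?take0.
      by apply/negP=> /perm_mem/(_ a); rewrite !inE eqxx (negPf ab).
    by rewrite perm_eq_swap_head.
  exists t.+1 => [|[|u] //= neq]; first by rewrite /= perm_cons.
  by rewrite perm_cons eq_t.
case=> t; elim: s s' t eq_sz => [|x s IHs] [|y s'] t //= [eq_sz] ne_t eq_t.
have [eq_xy | ne_xy] := eqVneq x y.
  subst y; apply: swap_cons; case: t ne_t eq_t => // t.
  rewrite /= perm_cons => ne_t eq_t; apply: (IHs _ t) => // u ne_u.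
  by have := eq_t u.+1 ne_u; rewrite /= perm_cons.
have t1 : t = 1.
  apply/eqP; apply: contraNT ne_xy; rewrite eq_sym => /eq_t /=.
  by rewrite !take0 => /perm_mem/(_ x); rewrite !inE eqxx => /esym.
subst t; have := eq_t 2 isT.
case: s s' eq_sz eq_t {IHs ne_t} => [|x' s] [|y' s'] //=.
  by move=> _ _ /perm_mem/(_ x); rewrite !inE eqxx (negPf ne_xy).
move=> [eq_sz] eq_t; rewrite !take0 => eq2.
have xy' : y' = x.
  have /perm_mem/(_ x) := eq2; rewrite !inE eqxx (negPf ne_xy).
  by move/esym/eqP.
have yx' : x' = y.
  have /perm_mem/(_ y) := eq2; rewrite !inE eqxx eq_sym (negPf ne_xy).
  by move/eqP.
subst x' y'; suff -> : s = s' by apply: swap_head.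
apply: perm_take_inj => // u.
by have := eq_t u.+2 isT; rewrite /= perm_eq_swap_head.
Qed.

(** * Words determined by the relative order of their letters *)

(* Occurrences of i are numbered from 0; if there are at most k of them, the
   result is the number of letters j in the whole of s. *)
Fixpoint preceding (s : seq nat) (i k j : nat) : nat :=
  if s is x :: s' then
    if x == i then (if k is k'.+1 then preceding s' i k' j else 0)
    else (x == j) + preceding s' i k j
  else 0.

Definition consec (a b : nat) := (a == b.+1) || (b == a.+1).

Definition one_preceding_differs (s s' : seq nat) : Prop :=
  exists i k j, [/\ j < i, k < count_mem i s,
    consec (preceding s i k j) (preceding s' i k j) &
    forall i' k' j', j' < i' -> k' < count_mem i' s ->
      (i', k', j') != (i, k, j) -> preceding s i' k' j' = preceding s' i' k' j'].

(** A letter put in front renumbers the occurrences of [i] exactly when it is [i]; the summand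
    [(x == i)] treats both cases in one equation. *)
Lemma preceding_shift x s i k j :
  j != i -> preceding (x :: s) i (k + (x == i)) j = (x == j) + preceding s i k j.
Proof.
rewrite eq_sym => ne_ij /=; have [-> | _] := eqVneq x i.
  by rewrite (negPf ne_ij) addn1.
by rewrite addn0.
Qed.

(** Where the words first diverge, look at the first remaining occurrence of the larger of the two
    letters: the smaller one precedes it in one word only. *)
Lemma preceding_inj s s' :
  perm_eq s s' ->
  (forall i k j, j < i -> k < count_mem i s ->
    preceding s i k j = preceding s' i k j) ->
  s = s'.
Proof.
elim: s s' => [|x s IHs] [|y s'] //.
- by move=> /perm_size.
- by move=> /perm_size.
have [<- | ne_xy] := eqVneq x y.
  rewrite perm_cons => eq_ss' eq_p; congr (_ :: _); apply: IHs => // i k j ltji ltk.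
  have := eq_p i (k + (x == i)) j ltji.
  rewrite !preceding_shift ?(ltn_eqF ltji) //= addnC ltn_add2l.
  by move=> /(_ ltk) /addnI.
move=> eq_ss' eq_p; exfalso.
have cnt i := permP eq_ss' (pred1 i).
case: (ltngtP x y) => [ltxy | ltyx | eqxy].
- have := eq_p y 0 x ltxy.
  by rewrite (cnt y) /= eqxx (negPf ne_xy) eqxx => /(_ isT).
- have := eq_p x 0 y ltyx.
  by rewrite /= !eqxx (eq_sym y) (negPf ne_xy) => /(_ isT).
- by rewrite eqxy eqxx in ne_xy.
Qed.

Lemma one_preceding_differs_sym s s' :
  perm_eq s s' -> one_preceding_differs s s' -> one_preceding_differs s' s.
Proof.
move=> /permP eqc [i [k [j [ltji ltk cs eqp]]]]; exists i, k, j; split=> //.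
- by rewrite -eqc.
- by rewrite /consec orbC.
by move=> i' k' j' ? ? ?; rewrite eqp // eqc.
Qed.

Lemma swap_one_preceding_differs s s' :
  swap s s' -> one_preceding_differs s s'.
Proof.
elim=> [a b r ab | x r r' _ [i [k [j [ltji ltk cs eqp]]]]].
  wlog ltba : a b ab / b < a.
    move=> W; case: (ltngtP a b) => [ltab | ltba | eqab].
    - apply: one_preceding_differs_sym; first by rewrite perm_eq_swap_head.
      by apply: W; rewrite // eq_sym.
    - exact: W.
    - by rewrite eqab eqxx in ab.
  have ba : b == a = false by apply/negbTE; rewrite eq_sym.
  (* The number of letters [b] before the first [a] is 0 in one word and 1 in the other. *)
  exists a, 0, b; split=> //=; rewrite ?eqxx ?ba //=.
  move=> i k j ltji _; have [ai | ai] := eqVneq a i; last first.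
    have [bi | //] := eqVneq b i; last by move=> _; rewrite addnCA.
    by case: k => // _; case: eqP => // aj; lia.
  subst i; rewrite ba; case: k => //; rewrite !xpair_eqE !eqxx /= eq_sym.
  by move=> /negPf ->.
exists i, (k + (x == i)), j; split=> //=.
- by rewrite addnC ltn_add2l.
- have nji : j != i by rewrite ltn_eqF.
  have := preceding_shift x r k nji; have := preceding_shift x r' k nji => /= -> ->.
  by move: cs; rewrite /consec; lia.
move=> i' k' j' lt' ltk' ne.
case: (eqVneq x i') ne ltk' => [xi'|xi'] ne ltk' //=.
  subst x; case: k' ne ltk' => [|k'] //= ne ltk'; apply: eqp => //.
  by apply: contraNN ne => /eqP[-> -> ->]; rewrite eqxx addn1.
congr (_ + _); apply: eqp => //.
by apply: contraNN ne => /eqP[ei -> ->]; rewrite -ei (negPf xi') addn0.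
Qed.

(** After the common beginning, let the words start with [x] and [y], where [y < x]. The count of
    [y] before the first [x] is 0 in one and positive in the other, so it is the one that changes,
    and its positive value is 1. Any second letter other than the one required by an exchange would
    alter a further count or push this one beyond 1. *)
Lemma one_preceding_differs_swap s s' :
  perm_eq s s' -> one_preceding_differs s s' -> swap s s'.
Proof.
elim: s s' => [|x s IHs] [|y s'].
- by move=> _ [i [k [j [_]]]].
- by move=> /perm_size.
- by move=> /perm_size.
have [<- | ne_xy] := eqVneq x y.
  rewrite perm_cons => eq_ss' [i [k [j [ltji ltk cs eqp]]]]; apply: swap_cons.
  have E i' k' j' : j' < i' -> preceding (x :: s) i' (k' + (x == i')) j' =
    (x == j') + preceding s i' k' j' by move=> lt'; rewrite preceding_shift // ltn_eqF.
  have E' i' k' j' : j' < i' -> preceding (x :: s') i' (k' + (x == i')) j' =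
    (x == j') + preceding s' i' k' j' by move=> lt'; rewrite preceding_shift // ltn_eqF.
  (* If [x = i], occurrence 0 is the common first letter, whose count is 0 in both words; so the
     changing count has a positive index. *)
  have [k1 k1E] : exists k1, k = k1 + (x == i).
    case: (eqVneq x i) cs => [<-|_ _]; last by exists k; rewrite addn0.
    by case: k {eqp ltk} => [|k]; rewrite /= eqxx // => _; exists k; rewrite addn1.
  subst k; apply: IHs => //; exists i, k1, j; split=> //.
  - by move: ltk; rewrite /= addnC ltn_add2l.
  - by move: cs; rewrite E // E' // /consec; lia.
  move=> i' k' j' lt' ltk' ne; apply: (@addnI (x == j')); rewrite -E // -E' //.
  apply: eqp => //; first by rewrite /= addnC ltn_add2l.
  apply: contraNN ne => /eqP[ei ek ej]; subst i' j'.
  by move/addIn: ek => ->.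
move=> eq_ss' opd; clear IHs.
wlog ltyx : x y s s' ne_xy eq_ss' opd / y < x.
  move=> W; case: (ltngtP x y) => [ltxy | ltyx | exy]; last by rewrite exy eqxx in ne_xy.
    apply/swap_sym/W => //; first by rewrite eq_sym.
    - by rewrite perm_sym.
    - exact: one_preceding_differs_sym.
  exact: W.
have neyx : y == x = false by apply: ltn_eqF.
have xy : x == y = false by rewrite eq_sym.
have cnt i := permP eq_ss' (pred1 i).
case: opd => i [k [j [ltji ltk cs eqp]]].
have [? ? ?] : [/\ i = x, k = 0 & j = y].
  have : (x, 0, y) == (i, k, j).
    apply/negPn/negP => ne; have := eqp _ _ _ ltyx _ ne.
    by rewrite /= eqxx neyx eqxx => /(_ isT).
  by case/eqP.
subst i k j.
have [r' s'E] : exists r', s' = x :: r'.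
  case: s' eq_ss' cs eqp cnt => [|e r'] /= eq_ss' cs eqp cnt.
    by have := perm_mem eq_ss' x; rewrite !inE eqxx xy.
  have [ex | ne_ex] := eqVneq e x; first by exists r'; rewrite ex.
  exfalso; move: cs; rewrite eqxx neyx (negPf ne_ex) eqxx /consec /=.
  have [ey | ne_ey] := eqVneq e y; first by [].
  move=> _; case: (ltngtP e x) => [ltex | ltxe | eex]; last by rewrite eex eqxx in ne_ex.
    have := eqp x 0 e ltex; rewrite !eqxx neyx (negPf ne_ex) /= => /(_ isT).
    rewrite !xpair_eqE (negPf ne_ey) andbF => /(_ isT); lia.
  have := eqp e 0 x ltxe; rewrite cnt eqxx (eq_sym x) (negPf ne_ex) (eq_sym y) (negPf ne_ey).
  rewrite !xpair_eqE (negPf ne_ex) eqxx eqxx neyx /=; lia.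
have [r sE] : exists r, s = y :: r.
  case: s eq_ss' eqp cnt {ltk cs} => [|e r] /= eq_ss' eqp cnt.
    by have := perm_mem eq_ss' y; rewrite !inE eqxx eq_sym xy.
  have [ey | ne_ey] := eqVneq e y; first by exists r; rewrite ey.
  exfalso; have [ex | ne_ex] := eqVneq e x.
    subst e; have := eqp x 1 y ltyx; rewrite !eqxx neyx /= => /(_ isT).
    by rewrite !xpair_eqE /= andbF /= => /(_ isT); lia.
  case: (ltngtP e y) => [ltey | ltye | eey]; last by rewrite eey eqxx in ne_ey.
    have := eqp y 0 e ltey; rewrite cnt xy !eqxx (negPf ne_ey).
    rewrite !xpair_eqE neyx /=; lia.
  have := eqp e 0 y ltye; rewrite /= !eqxx (eq_sym x) (negPf ne_ex) (eq_sym y) (negPf ne_ey).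
  rewrite !xpair_eqE (negPf ne_ex) xy /=; lia.
subst s s'; suff -> : r = r' by apply: swap_head.
apply: preceding_inj; first by move: eq_ss'; rewrite perm_eq_swap_head.
move=> i k j lt ltk'.
have nji : j != i by rewrite ltn_eqF.
(* This is the number, in the full words, of occurrence [k] of the tails. It is positive when
   [i = x], so the exceptional triple [(x, 0, y)] is avoided. *)
have := eqp i (k + (y == i) + (x == i)) j lt.
rewrite preceding_shift // preceding_shift // addnAC preceding_shift //.
rewrite preceding_shift // => H.
suff /H : k + (x == i) + (y == i) < count_mem i [:: x, y & r].
  rewrite !xpair_eqE.
  have -> : (i == x) && (k + (x == i) + (y == i) == 0) = false.
    by rewrite (eq_sym i); case: (x == i) => //=; lia.
  by move=> /(_ isT); lia.
by rewrite /= -addnA addnC -addnA !ltn_add2l.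
Qed.

(** * Shortest paths of the grid are monotone *)

Section GridPaths.
Variables (m : nat) (n : 'I_m -> nat).
Implicit Types (x y : grid n) (p : seq (grid n)).

Definition up_step : rel (grid n) := fun x y =>
  [exists i, [forall j, y j == x j + (j == i) :> nat]].

Definition height x : nat := \sum_i x i.

Lemma height_corner : height (grid_corner n) = \sum_i n i.
Proof. by apply: eq_bigr => i _; rewrite ffunE. Qed.

Lemma height_origin : height (grid_origin n) = 0.
Proof. by rewrite /height big1 // => i _; rewrite ffunE. Qed.

Lemma height_up_step x y : up_step x y -> height y = (height x).+1.
Proof.
case/existsP=> i /forallP eqy; rewrite /height.
under eq_bigr => j do rewrite (eqP (eqy j)).
rewrite big_split /= -addn1; congr (_ + _).
by rewrite (bigD1 i) //= eqxx big1 // => j /negPf ->.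
Qed.

Lemma grid_adjP x y :
  reflect (exists2 i, x i = (y i).+1 :> nat \/ y i = (x i).+1 :> nat &
             forall j, j != i -> x j = y j)
    (grid_adj x y).
Proof.
apply: (iffP existsP) => -[i].
  case/andP=> d1 /forallP eqj; exists i; first by lia.
  move=> j ne; apply/val_inj; have := eqj j; rewrite ne /= => /eqP; lia.
move=> d1 eqj; exists i; apply/andP; split; first by lia.
by apply/forallP => j; apply/implyP => /eqj ->.
Qed.

Lemma up_step_adj x y : up_step x y -> grid_adj x y.
Proof.
case/existsP=> i /forallP eqy; apply/grid_adjP; exists i.
  by right; rewrite (eqP (eqy i)) eqxx addn1.
by move=> j /negPf ne; apply/val_inj; rewrite /= (eqP (eqy j)) ne addn0.
Qed.

Lemma height_adj x y : grid_adj x y -> height y <= (height x).+1 ?= iff up_step x y.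
Proof.
case/grid_adjP=> i d1 eqj.
have eqr : \sum_(j | j != i) (x j : nat) = \sum_(j | j != i) (y j : nat).
  by apply: eq_bigr => j /eqj ->.
have hx : height x = x i + \sum_(j | j != i) (y j : nat).
  by rewrite /height (bigD1 i) //= eqr.
have hy : height y = y i + \sum_(j | j != i) (y j : nat).
  by rewrite /height (bigD1 i).
split; first by lia.
apply/eqP/idP=> [heq | /height_up_step //]; apply/existsP; exists i; apply/forallP => j.
have [-> | ne] := eqVneq j i; first by lia.
by rewrite eqj // addn0 eqxx.
Qed.

(** The equality case is carried along so that a path gaining as much height as it has edges is
    known to go up at every step. *)
Lemma height_path x p : path (@grid_adj m n) x p ->
  height (last x p) <= height x + size p ?= iff path up_step x p.
Proof.
elim: p x => [|y p IHp] x /=; first by rewrite addn0; split; rewrite ?eqxx.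
case/andP=> /height_adj leif_xy /IHp leif_p; rewrite andbC addnS -addSn.
by apply: leqif_trans leif_p _; rewrite /leqif eqn_add2r leq_add2r.
Qed.

Lemma up_step_from x : x != grid_corner n -> exists y, up_step x y.
Proof.
move=> nex; have [i lti] : exists i, x i < n i.
  apply/existsP; apply: contraNT nex => /existsPn ge; apply/eqP/ffunP => i.
  apply/val_inj/eqP; rewrite ffunE eqn_leq -ltnS ltn_ord leqNgt /=.
  exact: ge.
(* Since [x i < n i], every value is in range and [inord] does not fall back on its default. *)
exists (finfun (fun j : 'I_m => inord (x j + (j == i)) : 'I_(n j).+1)).
apply/existsP; exists i; apply/forallP => j; rewrite ffunE inordK //.
have [-> | _] := eqVneq j i; first by lia.
by rewrite addn0 ltn_ord.
Qed.

Lemma height_le_corner x : height x <= height (grid_corner n).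
Proof. by rewrite height_corner leq_sum // => i _; rewrite -ltnS. Qed.

(** Climb greedily, with [k] the height still missing. When [k = 0] the corner is reached, for
    otherwise one more step would exceed its maximal height. *)
Lemma up_path_exists k x : height x + k = height (grid_corner n) ->
  exists p, [/\ size p = k, path up_step x p & last x p = grid_corner n].
Proof.
elim: k x => [|k IHk] x hx.
  exists [::]; split=> //=; apply/eqP; apply: contraT => /up_step_from [y xy].
  by have := height_le_corner y; rewrite (height_up_step xy); lia.
have /up_step_from [y xy] : x != grid_corner n.
  by apply: contra_eqN hx => /eqP ->; lia.
have [|p [sz_p path_p last_p]] := IHk y; first by rewrite (height_up_step xy); lia.
by exists (y :: p); rewrite /= sz_p xy.
Qed.

Lemma up_path_uniq x p : path up_step x p -> uniq (x :: p).
Proof.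
move=> path_p; apply: (@sorted_uniq _ (relpre height ltn)).
- by move=> ? ? ? /=; apply: ltn_trans.
- by move=> ? /=; rewrite ltnn.
by apply: sub_path path_p => y z /height_up_step /= ->.
Qed.

Lemma dist_grid_le :
  dist (grid_graph n) (grid_origin n) (grid_corner n) <= \sum_i n i.
Proof.
set N := \sum_i n i; rewrite leqNgt; apply/negP => ltN.
have [|p [sz_p path_p last_p]] := @up_path_exists N (grid_origin n).
  by rewrite height_origin height_corner.
(* [dist] searches only the lengths below [#|grid n|], so the length [N] must be shown to lie in
   that range. *)
have ltNT : N < #|grid n|.
  by apply: leq_trans ltN _; rewrite (leq_trans (find_size _ _)) ?size_iota.
have := before_find 0 ltN; rewrite nth_iota // add0n => /negbT/negP; apply.
have sz_pP : size p == N by apply/eqP.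
apply/existsP; exists (Tuple sz_pP).
apply/and3P; split; [ | exact/eqP | exact: up_path_uniq].
by apply: sub_path path_p => ? ?; apply: up_step_adj.
Qed.

(** The height rises by the sum of the [n i], which is at most the length of the path by
    [height_path] and at least that length by [dist_grid_le]; equality forces every step up. *)
Lemma shortest_up_path
    (p : shortest_path (grid_graph n) (grid_origin n) (grid_corner n)) :
  path up_step (grid_origin n) (val p).
Proof.
have /and3P[path_p /eqP last_p _] := valP p.
have := height_path path_p; rewrite last_p => -[_ <-].
rewrite height_origin height_corner size_tuple eqn_leq dist_grid_le andbT.
by have [] := height_path path_p; rewrite last_p height_corner height_origin size_tuple.
Qed.

(** The default 0 occurs only for [x = y], which an up-step excludes. *)
Definition step_dir x y : nat := if [pick i | x i != y i] is Some i then i else 0.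

Lemma up_step_dir x y : up_step x y ->
  step_dir x y < m /\ forall j : 'I_m, y j = x j + (step_dir x y == j) :> nat.
Proof.
case/existsP=> i /forallP eqy; rewrite /step_dir; case: pickP => [k | eqxy].
  have [-> _ | ne] := eqVneq k i; last first.
    by rewrite -val_eqE /= (eqP (eqy k)) (negPf ne) addn0 eqxx.
  by split=> // j; rewrite (eqP (eqy j)) eq_sym.
by have := eqxy i; rewrite -val_eqE /= (eqP (eqy i)) eqxx addn1 eq_sym eqn_leq ltnn.
Qed.

Definition path_word x p : seq nat := pairmap step_dir x p.

Lemma path_word_lt x p : path up_step x p -> all (ltn^~ m) (path_word x p).
Proof.
by elim: p x => //= y p IHp x /andP[/up_step_dir[-> _] /IHp].
Qed.

Lemma nth_path_word x p t (i : 'I_m) : path up_step x p -> t <= size p ->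
  nth x (x :: p) t i = x i + count_mem (val i) (take t (path_word x p)) :> nat.
Proof.
elim: p x t => [|y p IHp] x [|t] //=; rewrite ?addn0 //.
case/andP=> /up_step_dir[_ eqy] path_p le_t.
have := IHp y t path_p le_t; rewrite (eqy i) -addnA => <-.
by rewrite (set_nth_default y).
Qed.

End GridPaths.

(** * Shortest paths as words *)

Lemma perm_eq_count_ord m (s s' : seq nat) :
  all (ltn^~ m) s -> all (ltn^~ m) s' ->
  (forall i : 'I_m, count_mem (val i) s = count_mem (val i) s') -> perm_eq s s'.
Proof.
move=> s_lt s'_lt eqc; apply/allP => a; rewrite mem_cat => a_in.
have lt_am : a < m.
  by case/orP: a_in; [move: s_lt | move: s'_lt] => /allP lt_ /lt_.
exact/eqP/(eqc (Ordinal lt_am)).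
Qed.

Section ShortestWord.
Variables (m : nat) (n : 'I_m -> nat).
Notation SP := (shortest_path (grid_graph n) (grid_origin n) (grid_corner n)).
Notation D := (dist (grid_graph n) (grid_origin n) (grid_corner n)).
Implicit Types p q : SP.

Definition sp_word p : seq nat := path_word (grid_origin n) (val p).

Lemma size_sp_word p : size (sp_word p) = D.
Proof. by rewrite size_pairmap size_tuple. Qed.

Lemma sp_word_lt p : all (ltn^~ m) (sp_word p).
Proof. exact/path_word_lt/shortest_up_path. Qed.

(** The origin is not stored, so entry [t] is the vertex reached after [t.+1] steps. *)
Lemma tnth_sp_word p (t : 'I_D) i :
  tnth (val p) t i = count_mem (val i) (take t.+1 (sp_word p)) :> nat.
Proof.
have := nth_path_word i (shortest_up_path p) (_ : t.+1 <= _).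
rewrite size_tuple ltn_ord => /(_ isT) /=.
by rewrite (tnth_nth (grid_origin n)) => ->; rewrite ffunE.
Qed.

Lemma count_sp_word p (i : 'I_m) : count_mem (val i) (sp_word p) = n i.
Proof.
have := nth_path_word i (shortest_up_path p) (leqnn _).
have /and3P[_ /eqP last_p _] := valP p.
rewrite nth_last /= last_p !ffunE /= add0n => ->.
by rewrite take_oversize // size_pairmap.
Qed.

Lemma perm_sp_word p q : perm_eq (sp_word p) (sp_word q).
Proof.
by apply: (@perm_eq_count_ord m); rewrite ?sp_word_lt // => i; rewrite !count_sp_word.
Qed.

Lemma perm_take_sp_word p q (t : 'I_D) :
  perm_eq (take t.+1 (sp_word p)) (take t.+1 (sp_word q)) =
  (tnth (val p) t == tnth (val q) t).
Proof.
apply/idP/eqP => [/permP eqpq | eqpq].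
  by apply/ffunP => i; apply/val_inj; rewrite /= !tnth_sp_word eqpq.
have take_lt r : all (ltn^~ m) (take t.+1 (sp_word r)).
  by apply/allP => a /mem_take; apply: (allP (sp_word_lt r)).
by apply: (@perm_eq_count_ord m) => // i; rewrite -!tnth_sp_word eqpq.
Qed.

Lemma sp_word_inj : injective sp_word.
Proof.
move=> p q eqw; apply/val_inj/eq_from_tnth => t; apply/eqP.
by rewrite -perm_take_sp_word eqw.
Qed.

(** Position [t] of the tuples corresponds to prefixes of length [t.+1]. The empty prefix and those
    of length at least [D] agree up to permutation for any two paths, so a differing prefix always
    comes from a stored position. *)
Lemma sp_adj_swap p q : sp_adj p q <-> swap (sp_word p) (sp_word q).
Proof.
rewrite -swapP ?size_sp_word //; split=> [/cards1P[t eqt] | [t]].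
  have neqP (u : 'I_D) :
      perm_eq (take u.+1 (sp_word p)) (take u.+1 (sp_word q)) = (u != t).
    have /setP/(_ u) := eqt; rewrite !inE perm_take_sp_word => <-.
    by rewrite negbK.
  exists t.+1 => [|[|u]]; rewrite ?take0 ?neqP ?eqxx // => ne_u.
  have [lt_u | ge_u] := ltnP u D; first by rewrite (neqP (Ordinal lt_u)).
  by rewrite !take_oversize ?size_sp_word ?perm_sp_word // ltnW.
case: t => [|t]; rewrite ?take0 // => ne_t eq_t.
have lt_t : t < D.
  rewrite ltnNge; apply: contraNN ne_t => ge_t.
  by rewrite !take_oversize ?size_sp_word ?perm_sp_word // ltnW.
apply/cards1P; exists (Ordinal lt_t); apply/setP => u.
rewrite !inE -perm_take_sp_word; have [-> | ne_u] := eqVneq u (Ordinal lt_t).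
  by rewrite ne_t.
by rewrite eq_t.
Qed.

(** * Lattice coordinates of a shortest path *)

(** A triple of a letter [i], one of its [n i] occurrences, and a smaller letter; the type ['I_i]
    encodes the condition [j < i]. *)
Definition coord_index : finType := {i : 'I_m & ('I_(n i) * 'I_i)%type}.

Lemma card_coord_index : #|coord_index| = \sum_(i < m | 1 <= i) i * n i.
Proof.
rewrite card_tagged sumnE big_map big_enum /= [RHS]big_mkcond.
apply: eq_bigr => i _; rewrite card_prod !card_ord mulnC.
by case: (val i) => //; rewrite mul0n.
Qed.

(** Forgetting the dependent bounds makes the results on words over [nat] applicable. *)
Definition coord_nats (u : coord_index) : nat * nat * nat :=
  (val (tag u), val (tagged u).1, val (tagged u).2).

Lemma coord_nats_inj : injective coord_nats.
Proof.
move=> [i [k j]] [i' [k' j']] [/val_inj ei]; subst i' => /= ek ej.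
by rewrite (val_inj ek) (val_inj ej).
Qed.

Lemma coord_nats_bounds p u i k j :
  coord_nats u = (i, k, j) -> j < i /\ k < count_mem i (sp_word p).
Proof.
by case: u => i' [k' j'] [<- <- <-]; rewrite /= count_sp_word !ltn_ord.
Qed.

Lemma coord_nats_surj p i k j : j < i -> k < count_mem i (sp_word p) ->
  exists u, coord_nats u = (i, k, j).
Proof.
move=> ltji ltk; have lti : i < m.
  have : i \in sp_word p by rewrite -has_pred1 has_count (leq_trans _ ltk).
  exact: (allP (sp_word_lt p)).
move: ltk; rewrite -[i]/(val (Ordinal lti)) count_sp_word => ltk.
by exists (existT _ (Ordinal lti) (Ordinal ltk, Ordinal ltji)).
Qed.

Definition sp_coord p (u : coord_index) : nat :=
  let: (i, k, j) := coord_nats u in preceding (sp_word p) i k j.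

Lemma sp_coord_inj p q : sp_coord p =1 sp_coord q -> p = q.
Proof.
move=> eqpq; apply/sp_word_inj/preceding_inj => [|i k j ltji ltk].
  exact: perm_sp_word.
have [u eu] := coord_nats_surj ltji ltk.
by have := eqpq u; rewrite /sp_coord eu.
Qed.

Lemma sp_coord_swap p q :
  (exists2 u, consec (sp_coord p u) (sp_coord q u) &
     forall v, v != u -> sp_coord p v = sp_coord q v) <->
  swap (sp_word p) (sp_word q).
Proof.
split=> [[u cs eqv] | /swap_one_preceding_differs].
  apply: one_preceding_differs_swap; first exact: perm_sp_word.
  case eu: (coord_nats u) => [[i k] j].
  have [ltji ltk] := coord_nats_bounds p eu.
  exists i, k, j; split=> // [|i' k' j' ltji' ltk' ne].
    by move: cs; rewrite /sp_coord eu.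
  have [v ev] := coord_nats_surj ltji' ltk'.
  have := eqv v; rewrite /sp_coord ev; apply.
  by apply: contraNneq ne => vu; rewrite -ev vu eu.
case=> i [k [j [ltji ltk cs eqv]]].
have [u eu] := coord_nats_surj ltji ltk.
exists u => [|v ne]; rewrite /sp_coord ?eu //.
case ev: (coord_nats v) => [[i' k'] j'].
have [ltji' ltk'] := coord_nats_bounds p ev.
apply: eqv => //; apply: contraNN ne => /eqP e'.
by apply/eqP/coord_nats_inj; rewrite eu ev.
Qed.

End ShortestWord.

(* The index i : 'I_m stands for i + 1 in 1, ..., m. *)
Theorem theorem23 (m : nat) (n : 'I_m -> nat)
    (hm : 1 <= m) (hn : forall i : 'I_m, 1 <= n i) :
  let M := \sum_(i < m | 1 <= i) i * n i in
  exists W : pred {ffun 'I_M -> int},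
    isomorphic
      (shortest_path_graph (grid_graph n) (grid_origin n) (grid_corner n))
      (induced_subgraph (lattice_graph M) W).
Proof.
move=> M; have eqM : M = #|coord_index n| by rewrite card_coord_index.
(* Any enumeration of the triples serves to name the axes of the lattice. *)
pose idx (a : 'I_M) : coord_index n := enum_val (cast_ord eqM a).
pose idx_inv u : 'I_M := cast_ord (esym eqM) (enum_rank u).
have idx_invK : cancel idx_inv idx.
  by move=> u; rewrite /idx cast_ordKV enum_rankK.
have idxK : cancel idx idx_inv by move=> a; rewrite /idx_inv enum_valK cast_ordK.
pose F p : {ffun 'I_M -> int} := [ffun a => Posz (sp_coord p (idx a))].
have F_inj : injective F.
  move=> p q /ffunP eqF; apply: sp_coord_inj => u.
  by have := eqF (idx_inv u); rewrite !ffunE idx_invK => -[].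
(* The vertex set is the image of [F]; injectivity makes [iinv] a two-sided inverse. *)
exists [pred x in codom F].
exists (fun p => exist _ (F p) (codom_f F p)); split.
  exists (fun x => iinv (svalP x)) => [p | x].
    by apply: F_inj; rewrite f_iinv.
  by apply: val_inj; rewrite /= f_iinv.
move=> p q; apply/idP/idP.
  case/existsP=> a /andP[cs /forallP eqb].
  apply/sp_adj_swap/sp_coord_swap; exists (idx a).
    by move: cs; rewrite /= !ffunE /consec; lia.
  move=> v; rewrite -(idx_invK v) (can_eq idxK) => ne.
  by have := eqb (idx_inv v); rewrite ne /= !ffunE => /eqP[].
move/sp_adj_swap/sp_coord_swap => [u cs eqv]; apply/existsP; exists (idx_inv u).
rewrite /= !ffunE idx_invK; apply/andP; split; first by move: cs; rewrite /consec; lia.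
apply/forallP => b; apply/implyP => ne; rewrite !ffunE eqv //.
by rewrite -(can_eq idx_invK) idxK.
Qed.
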